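(* Let $A$ and $B$ be two points of a rigid body moving in the plane with angular velocity $\omega(t)$, with position vectors $\mathbf r_A(t),\mathbf r_B(t)$ (sufficiently often differentiable in time $t$) and $\mathbf r_{AB}=\mathbf r_B-\mathbf r_A$. Then the motion of $B$ is a combination of the translational motion of $A$ and a superimposed rotational motion of $B$ about $A$ having a radial and a tangential angular component: for every integer $k\ge 0$ one has $$\mathbf r_B^{(k)}=\mathbf r_A^{(k)}-\Omega_r^{(k)}\,\mathbf r_{AB}+\Omega_t^{(k)}\,\tilde{\mathbf r}_{AB},$$ where the scalar functions $\Omega_r^{(k)},\Omega_t^{(k)}$ start with $\Omega_r^{(0)}=-1$, $\Omega_t^{(0)}=0$ and satisfy the linear recurrence expressed by $$\mathbf r_B^{(k+1)}=\mathbf r_A^{(k+1)}-\underbrace{\bigl(\dot\Omega_r^{(k)}+\omega\,\Omega_t^{(k)}\bigr)}_{\Omega_r^{(k+1)}}\mathbf r_{AB}+\underbrace{\bigl(\dot\Omega_t^{(k)}-\omega\,\Omega_r^{(k)}\bigr)}_{\Omega_t^{(k+1)}}\tilde{\mathbf r}_{AB}.$$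
   Context: $\mathbf J=\begin{pmatrix}0&-1\\1&0\end{pmatrix}$ and $\tilde{\mathbf a}=\mathbf J\mathbf a$ for $\mathbf a\in\mathbb R^2$. Rigid body with angular velocity $\omega$: the vector between any two body points $A,B$ has constant length and satisfies $\dot{\mathbf r}_{AB}=\omega\,\tilde{\mathbf r}_{AB}$. Dots denote time derivatives; $\mathbf r_A^{(k)},\mathbf r_B^{(k)}$ are $k$-th time derivatives. For the scalars $\Omega_r^{(k)},\Omega_t^{(k)}$ (radial and tangential angular acceleration components of order $k$) the superscript $(k)$ is an index, and $\dot\Omega_r^{(k)},\dot\Omega_t^{(k)}$ are their first time derivatives. *)

(* Defs.v *)
From HB Require Import structures.
From mathcomp Require Import all_boot all_order all_algebra.
From mathcomp Require Import all_classical all_reals all_analysis.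
Set Implicit Arguments. Unset Strict Implicit. Unset Printing Implicit Defensive.
Import Order.TTheory GRing.Theory Num.Theory.
Import numFieldNormedType.Exports.
Local Open Scope ring_scope.

Definition rotJ (R : realType) : 'M[R]_2 := delta_mx 1 0 - delta_mx 0 1.

Definition tilde (R : realType) (a : 'cV[R]_2) : 'cV[R]_2 := rotJ R *m a.

(* The canonical norm `|a| on matrices is the sup norm, hence this definition. *)
Definition euclid_len (R : realType) (a : 'cV[R]_2) : R :=
  Num.sqrt (\sum_i a i 0 ^+ 2).

Definition rAB (R : realType) (P : Type) (r : P -> R -> 'cV[R]_2) (A B : P)
  (t : R) : 'cV[R]_2 := r B t - r A t.

(* [P] labels the points of the body and [r X t] is the position of [X] at
   time [t]. *)
Definition rigid_motion (R : realType) (P : Type) (r : P -> R -> 'cV[R]_2)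
    (omega : R -> R) : Prop :=
  forall A B : P,
    (forall s t : R, euclid_len (rAB r A B s) = euclid_len (rAB r A B t)) /\
    (forall t : R, is_derive t 1 (rAB r A B) (omega t *: tilde (rAB r A B t))).

(* [derive1n] is total, so differentiability has to be required separately. *)
Definition n_times_derivable (R : realType) (V : normedModType R) (n : nat)
    (f : R -> V) : Prop :=
  forall k : nat, (k < n)%N -> forall t : R, derivable (derive1n k f) t 1.

Fixpoint Omega_r (R : realType) (omega : R -> R) (k : nat) {struct k} : R -> R :=
  match k with
  | 0%N => fun _ => -1
  | S j => fun t => derive1 (Omega_r omega j) t + omega t * Omega_t omega j t
  end
with Omega_t (R : realType) (omega : R -> R) (k : nat) {struct k} : R -> R :=
  match k with
  | 0%N => fun _ => 0
  | S j => fun t => derive1 (Omega_t omega j) t - omega t * Omega_r omega j t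
  end.

(* Main.v *)
(* The vector [u = r_AB] rotates, [u' = omega (tilde u)], so [tilde (tilde u) = - u]
   and the product rule turn a formula for [u^(k)] into one for [u^(k+1)],
   provided that the coefficients are derivable.  They are when [u] does not
   vanish: being the coordinates of [u^(k)] in the orthogonal frame
   [(u, tilde u)], they are scalar products divided by the constant [|u|^2].
   Since [|u|] is constant, [u] either never vanishes or is identically zero,
   and then the formulas are trivial. *)
Require Import Defs.
From HB Require Import structures.
From mathcomp Require Import all_boot all_order all_algebra.
From mathcomp Require Import all_classical all_reals all_analysis.
From mathcomp Require Import ring.
Set Implicit Arguments. Unset Strict Implicit. Unset Printing Implicit Defensive.
Import Order.TTheory GRing.Theory Num.Theory.
Import numFieldNormedType.Exports.
Local Open Scope ring_scope.

Lemma is_derive_mxP (R : realFieldType) (V : normedModType R) (m n : nat)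
    (M : V -> 'M[R]_(m, n)) (t v : V) (dM : 'M[R]_(m, n)) :
  is_derive t v M dM <->
  forall i j, is_derive t v (fun s => M s i j) (dM i j).
Proof.
split=> [[Mtv <-] i j|Mtv].
  by split; [exact: (derivable_mxP M t v).1|rewrite derive_mx// mxE].
have dMtv : derivable M t v.
  by apply/derivable_mxP => i j; have [] := Mtv i j.
split=> //; rewrite derive_mx//; apply/matrixP => i j.
by rewrite mxE; have [] := Mtv i j.
Qed.

Lemma is_derive_scale_mx (R : realFieldType) (V : normedModType R) (m n : nat)
    (c : V -> R) (M : V -> 'M[R]_(m, n)) (t v : V) (dc : R) (dM : 'M[R]_(m, n)) :
  is_derive t v c dc -> is_derive t v M dM ->
  is_derive t v (fun s => c s *: M s) (dc *: M t + c t *: dM).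
Proof.
move=> ctv /is_derive_mxP Mtv; apply/is_derive_mxP => i j.
rewrite (_ : (fun s => (c s *: M s) i j) = c * (fun s => M s i j)); last first.
  by apply/funext => s; rewrite mxE.
have cMtv := is_deriveM ctv (Mtv i j); apply: is_derive_eq.
by rewrite !mxE addrC /GRing.scale/= [M t i j * _]mulrC.
Qed.

Section derive1n_sub.
Variables (R : realType) (V : normedModType R) (n : nat) (f g : R -> V).
Hypotheses (df : n_times_derivable n f) (dg : n_times_derivable n g).

(** Order [k] differentiates only derivatives of order below [k], so [k = n] is still allowed. *)
Lemma derive1nB (k : nat) : (k <= n)%N ->
  derive1n k (f - g) = derive1n k f - derive1n k g.
Proof.
elim: k => [//|k IHk] kn; rewrite !derive1nS IHk ?(ltnW kn)//.
apply/funext => t; rewrite derive1E deriveB; [|exact: df|exact: dg].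
by rewrite -!derive1E.
Qed.

Lemma n_times_derivableB : n_times_derivable n (f - g).
Proof.
move=> k kn t; rewrite derive1nB ?(ltnW kn)//.
by apply: derivableB; [exact: df|exact: dg].
Qed.

End derive1n_sub.

Definition dot (R : realType) (a b : 'cV[R]_2) : R := \sum_i a i 0 * b i 0.

Section dot_tilde.
Variable R : realType.
Implicit Types (a b : 'cV[R]_2) (c d : R).

Lemma rotJE (i j : 'I_2) : rotJ R i j =
  ((i == 1) && (j == 0))%:R - ((i == 0) && (j == 1))%:R.
Proof. by rewrite !mxE. Qed.

Lemma tilde0E a : tilde a 0 0 = - a 1 0.
Proof.
by rewrite mxE !big_ord_recl big_ord0 !rotJE/= (_ : lift 0 0 = 1 :> 'I_2)
  ?subrr ?mul0r ?add0r ?addr0 ?mulN1r //; apply/val_inj.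
Qed.

Lemma tilde1E a : tilde a 1 0 = a 0 0.
Proof.
by rewrite mxE !big_ord_recl big_ord0 !rotJE/= (_ : lift 0 0 = 1 :> 'I_2)
  ?subrr ?subr0 ?mul0r ?mul1r ?addr0 //; apply/val_inj.
Qed.

Lemma cV2P a b : a 0 0 = b 0 0 -> a 1 0 = b 1 0 -> a = b.
Proof.
move=> ab0 ab1; apply/matrixP => i j; rewrite (ord1 j).
have [->//|i0] := eqVneq i 0; rewrite (_ : i = 1)//.
by apply/val_inj; case: i i0 => -[|[|]].
Qed.

Lemma tilde0 : tilde (0 : 'cV[R]_2) = 0.
Proof. exact: mulmx0. Qed.

Lemma tildeZ c a : tilde (c *: a) = c *: tilde a.
Proof. exact/esym/scalemxAr. Qed.

Lemma tildeK a : tilde (tilde a) = - a.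
Proof. by apply: cV2P; rewrite !(tilde0E, tilde1E) mxE. Qed.

Lemma dotE a b : dot a b = a 0 0 * b 0 0 + a 1 0 * b 1 0.
Proof.
rewrite /dot !big_ord_recl big_ord0 addr0; congr (_ + a _ _ * b _ _);
  exact/val_inj.
Qed.

(** As [tilde a] is orthogonal to [a] and equally long, pairing with [a], or with [tilde a] in the
    next lemma, isolates one coordinate. *)
Lemma dot_rotate_l c d a : dot (- c *: a + d *: tilde a) a = - c * dot a a.
Proof. by rewrite !dotE !(tilde0E, tilde1E, mxE); ring. Qed.

Lemma dot_rotate_r c d a : dot (- c *: a + d *: tilde a) (tilde a) = d * dot a a.
Proof. by rewrite !dotE !(tilde0E, tilde1E, mxE); ring. Qed.

Lemma euclid_len_sqr a : euclid_len a ^+ 2 = dot a a.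
Proof.
rewrite sqr_sqrtr; last by apply: sumr_ge0 => i _; exact: sqr_ge0.
by apply: eq_bigr => i _; rewrite expr2.
Qed.

Lemma dot_eq0 a : (dot a a == 0) = (a == 0).
Proof.
apply/eqP/eqP => [aa0|->]; last by rewrite dotE !mxE !mul0r addr0.
have /psumr_eq0P/(_ aa0) a0 i : true -> 0 <= a i 0 * a i 0.
  by move=> _; rewrite -expr2 sqr_ge0.
by apply: cV2P; rewrite mxE; apply/eqP; rewrite -sqrf_eq0 expr2 a0.
Qed.

Lemma is_derive_tilde (V : normedModType R) (f : V -> 'cV[R]_2) (t v : V)
    (df : 'cV[R]_2) :
  is_derive t v f df -> is_derive t v (fun s => tilde (f s)) (tilde df).
Proof.
move=> /is_derive_mxP ftv; apply/is_derive_mxP => i j; rewrite (ord1 j).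
have [->|i0] := eqVneq i 0.
  under eq_fun do rewrite tilde0E.
  by rewrite tilde0E; apply: is_deriveN.
rewrite (_ : i = 1); last by apply/val_inj; case: i i0 => -[|[|]].
by under eq_fun do rewrite tilde1E; rewrite tilde1E.
Qed.

Lemma derivable_dot (V : normedModType R) (f g : V -> 'cV[R]_2) (t v : V) :
  derivable f t v -> derivable g t v -> derivable (fun s => dot (f s) (g s)) t v.
Proof.
move=> /derivable_mxP ftv /derivable_mxP gtv.
under eq_fun do rewrite dotE.
by apply: derivableD; apply: derivableM.
Qed.

End dot_tilde.

Section rotating_vector.
Variables (R : realType) (omega : R -> R) (u : R -> 'cV[R]_2) (l : R) (n : nat).
Hypothesis du : forall t : R, is_derive t 1 u (omega t *: tilde (u t)).
Hypotheses (l0 : l != 0) (ul : forall t, dot (u t) (u t) = l).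
Hypothesis dnu : n_times_derivable n u.

Let rotating k := forall t, derive1n k u t =
  - Omega_r omega k t *: u t + Omega_t omega k t *: tilde (u t).

Let derivable_u t : derivable u t 1.
Proof. by have [] := du t. Qed.

Let derivable_tilde_u t : derivable (fun s => tilde (u s)) t 1.
Proof. by have [] := is_derive_tilde (du t). Qed.

(** The formula of order [k] is a premise, so that the induction proving the formulas can call this
    result at each step. The bound is strict because the [k]-th derivative of [u] must itself be
    derivable. *)
Let derivable_Omega_rotating k t : (k < n)%N -> rotating k ->
  derivable (Omega_r omega k) t 1 /\ derivable (Omega_t omega k) t 1.
Proof.
move=> kn rot; split.
- rewrite (_ : Omega_r omega k =
      - l^-1 \*: (fun s => dot (derive1n k u s) (u s))).
    by apply: derivableZ; apply: derivable_dot; [exact: dnu|].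
  by apply/funext => s /=; rewrite rot dot_rotate_l ul /GRing.scale/=; field.
- rewrite (_ : Omega_t omega k =
      l^-1 \*: (fun s => dot (derive1n k u s) (tilde (u s)))).
    by apply: derivableZ; apply: derivable_dot; [exact: dnu|].
  by apply/funext => s /=; rewrite rot dot_rotate_r ul /GRing.scale/=; field.
Qed.

Lemma derive1n_rotating k : (k <= n)%N -> forall t, derive1n k u t =
  - Omega_r omega k t *: u t + Omega_t omega k t *: tilde (u t).
Proof.
(* Order 0 reads [u = - (-1) u + 0], which is why [Omega_r] starts at -1. *)
elim: k => [|k IHk] kn t; first by rewrite opprK scale1r scale0r addr0.
have rot := IHk (ltnW kn).
have [dr dt] := derivable_Omega_rotating t kn rot.
(* The formula holds at all times, so it may be differentiated as an identity of functions. *)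
rewrite derive1nS derive1E (funext rot).
have dr' : is_derive t 1 (fun s => - Omega_r omega k s)
      (- derive1 (Omega_r omega k) t).
  by apply: is_deriveN; rewrite derive1E; apply: derivableP.
have dt' : is_derive t 1 (Omega_t omega k) (derive1 (Omega_t omega k) t).
  by rewrite derive1E; apply: derivableP.
have dv := is_deriveD (is_derive_scale_mx dr' (du t))
                      (is_derive_scale_mx dt' (is_derive_tilde (du t))).
(* Differentiating [u] sends [Omega_r] into the tangential part; differentiating [tilde u] sends
   [Omega_t] into the radial part with a sign from [tildeK]. This is the recurrence. *)
rewrite (@derive_val _ _ _ _ _ _ _ dv) tildeZ tildeK /=.
by apply/matrixP => i j; rewrite !mxE; ring.
Qed.

Lemma derivable_Omega k t : (k < n)%N ->
  derivable (Omega_r omega k) t 1 /\ derivable (Omega_t omega k) t 1.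
Proof.
by move=> kn; apply: derivable_Omega_rotating => //; apply/derive1n_rotating/ltnW.
Qed.

End rotating_vector.

(* "Sufficiently often differentiable" is [n] times for the formulas up to
   order [n].  The derivability of the Omega's follows from that of [r A] and
   [r B] only if the two points do not coincide: otherwise [r A] and [r B] carry
   no information on [omega]. *)
Theorem theorem3p1 (R : realType) (P : Type) (r : P -> R -> 'cV[R]_2)
    (omega : R -> R) (A B : P) (n : nat)
    (rigid : rigid_motion r omega)
    (dA : n_times_derivable n (r A)) (dB : n_times_derivable n (r B)) :
  [/\ (forall t : R, Omega_r omega 0 t = -1),
      (forall t : R, Omega_t omega 0 t = 0),
      (forall k : nat, (k <= n)%N -> forall t : R,
         derive1n k (r B) t =
         derive1n k (r A) t
         - Omega_r omega k t *: rAB r A B t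
         + Omega_t omega k t *: tilde (rAB r A B t)) &
      (forall k : nat, (k < n)%N -> forall t : R,
         [/\ r A t <> r B t ->
               derivable (Omega_r omega k) t 1 /\
               derivable (Omega_t omega k) t 1,
             Omega_r omega k.+1 t =
               derive1 (Omega_r omega k) t + omega t * Omega_t omega k t,
             Omega_t omega k.+1 t =
               derive1 (Omega_t omega k) t - omega t * Omega_r omega k t &
             derive1n k.+1 (r B) t =
             derive1n k.+1 (r A) t
             - (derive1 (Omega_r omega k) t + omega t * Omega_t omega k t)
                 *: rAB r A B t
             + (derive1 (Omega_t omega k) t - omega t * Omega_r omega k t)
                 *: tilde (rAB r A B t)])].
Proof.
pose u := rAB r A B.
have rABE : u = r B - r A by [].
(* Time 0 is an arbitrary reference: constancy of length lets [u 0] decide between the two cases. *)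
have len t : dot (u t) (u t) = dot (u 0) (u 0).
  by rewrite -!euclid_len_sqr ((rigid A B).1 t 0).
have [u0|u0] := eqVneq (u 0) 0.
- have uE t : u t = 0 by apply/eqP; rewrite -dot_eq0 len dot_eq0 u0.
  have -> : r B = r A.
    by apply/funext => t; apply/eqP; rewrite -subr_eq0; apply/eqP/uE.
  have rABz t : rAB r A B t = 0 := uE t.
  split=> // k kn t; first by rewrite rABz tilde0 !scaler0 subr0 addr0.
  (* The derivability clause is vacuous here, the two points coinciding at all times. *)
  by split=> //; rewrite rABz tilde0 !scaler0 subr0 addr0.
- have du := (rigid A B).2; have dnu := n_times_derivableB dB dA.
  have l0 : dot (u 0) (u 0) != 0 by rewrite dot_eq0.
  have main k : (k <= n)%N -> forall t, derive1n k (r B) t =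
      derive1n k (r A) t - Omega_r omega k t *: rAB r A B t
      + Omega_t omega k t *: tilde (rAB r A B t).
    move=> kn t; rewrite -addrA -scaleNr -(derive1n_rotating du l0 len dnu kn).
    (* The rotating part is the derivative of [r B - r A]; adding that of [r A] leaves that of
       [r B]. *)
    by rewrite -/u rABE (derive1nB dB dA kn) /= addrC subrK.
  (* The recurrences hold by unfolding, so the last formula is the one of order [k.+1]. *)
  split=> // k kn t; split=> // [_|]; last exact: (main k.+1).
  exact: (derivable_Omega du l0 len dnu _ kn).
Qed.
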